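(* The functor $\mathcal{T}:\mathbf{Law}\to\mathbf{Mnd}$, $\mathbf{L}\mapsto T_{\mathbf{L}}$, restricts to a functor $\mathbf{SMLaw}\to\mathbf{CMnd}$. Further, this restriction is left adjoint to $\mathcal{K}\ell_{\mathbb{N}}:\mathbf{CMnd}\to\mathbf{SMLaw}$.
   Context: $\mathbf{Mnd}$ is the category of monads on $\mathbf{Sets}$. Each monad $T$ on $\mathbf{Sets}$ has a canonical strength $\mathsf{st}:T(X)\times Y\to T(X\times Y)$, $\mathsf{st}(u,y)=T(\lambda x.(x,y))(u)$, with which monad maps automatically commute. Let $\gamma$ be the swap map and $\mathsf{st}'=T(\gamma)\circ\mathsf{st}\circ\gamma:X\times T(Y)\to T(X\times Y)$. $T$ is commutative if $\mu\circ T(\mathsf{st}')\circ\mathsf{st}=\mu\circ T(\mathsf{st})\circ\mathsf{st}':T(X)\times T(Y)\to T(X\times Y)$; this map is then written $\mathsf{dst}$. $\mathbf{CMnd}$ is the full subcategory of $\mathbf{Mnd}$ of commutative monads. Lawvere theories. For $n\in\mathbb{N}$ let $\underline{n}=\{0,\ldots,n-1\}$. $\aleph_0$ has natural numbers as objects and functions $\underline n\to\underline m$ as morphisms $n\to m$; $(+,0)$ gives finite coproducts. A Lawvere theory is a small category $\mathbf{L}$ with natural numbers as objects together with a functor $\aleph_0\to\mathbf{L}$ that is the identity on objects and strictly preserves finite coproducts (so $(+,0)$ forms finite coproducts in $\mathbf L$). Morphisms are functors that are the identity on objects and strictly preserve finite coproducts; this is $\mathbf{Law}$. Tensor on $\aleph_0$: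 on objects, multiplication $n\times m$ of numbers, with unit $1$. Let $\mathsf{co}_{n,m}:\underline{n\times m}\to\underline n\times\underline m$ be the bijection with $\mathsf{co}(c)=(a,b)\iff c=a\cdot m+b$. On morphisms $f\otimes g=\mathsf{co}^{-1}\circ(f\times g)\circ\mathsf{co}$, and the symmetric monoidal isomorphisms are transported from $(\mathbf{Sets},\times,1)$ along $\mathsf{co}$. $\mathbf{SMLaw}$: objects are Lawvere theories $\mathbf{L}$ with a symmetric monoidal structure such that $\aleph_0\to\mathbf{L}$ strictly preserves the symmetric monoidal structure just described (and the coproducts); morphisms are morphisms in $\mathbf{Law}$ that strictly preserve the tensor structure. Functor $\mathcal{K}\ell_{\mathbb N}$: $\mathcal{K}\ell_{\mathbb{N}}(T)$ has natural numbers as objects, functions $\underline n\to T(\underline m)$ as morphisms $n\to m$, Kleisli composition, coproducts from $\mathbf{Sets}$; a monad map $\sigma$ acts by $f\mapsto\sigma\circ f$. For $T$ commutative, the tensor of $f:n\to p$ and $g:m\to q$ is $T(\mathsf{co}^{-1})\circ\mathsf{dst}\circ(f\times g)\circ\mathsf{co}$. Functor $\mathcal{T}$: $T_{\mathbf L}(X)=\big(\coprod_{i\in\mathbb N}\mathbf{L}(1,i)\times X^i\big)/\!\sim$, where $\sim$ is the least equivalence relation with $\kappa_m(f\circ g,v)\sim\kappa_i(g,v\circ f)$ for each $f:i\to m$ in $\aleph_0$ (also viewed in $\mathbf{L}$), $g\in\mathbf{L}(1,i)$, $v\in X^m$. On functions, $T_{\mathbf L}(h)[\kappa_i(g,v)]=[\kappa_i(g,h\circ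 v)]$. Unit: $x\mapsto[\kappa_1(\mathrm{id}_1,x)]$. Multiplication: $\mu([\kappa_i(g,v)])=[\kappa_j((g_0+\cdots+g_{i-1})\circ g,[v_0,\ldots,v_{i-1}])]$, where $v(a)=[\kappa_{j_a}(g_a,v_a)]$ for $a<i$ and $j=j_0+\cdots+j_{i-1}$. A morphism $F:\mathbf{L}\to\mathbf{K}$ is sent to the monad map $[\kappa_i(g,v)]\mapsto[\kappa_i(F(g),v)]$. *)

(* Defs.v *)
From Stdlib Require Relation_Operators.
From mathcomp Require Import all_boot all_order.
From mathcomp Require Import boolp.

Set Implicit Arguments.
Unset Strict Implicit.
Unset Printing Implicit Defensive.
Local Obligation Tactic := idtac.

Record category := Category {
  obj :> Type;
  hom : obj -> obj -> Type;
  idm : forall A, hom A A;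
  cmp : forall A B C, hom B C -> hom A B -> hom A C;
  cmp1m : forall A B (f : hom A B), cmp (idm B) f = f;
  cmpm1 : forall A B (f : hom A B), cmp f (idm A) = f;
  cmpA : forall A B C D (h : hom C D) (g : hom B C) (f : hom A B),
    cmp h (cmp g f) = cmp (cmp h g) f }.

Arguments idm {c} A.

Record functor (C D : category) := Functor {
  fobj :> C -> D;
  fhom : forall A B, hom A B -> hom (fobj A) (fobj B);
  fhom1 : forall A, fhom (idm A) = idm (fobj A);
  fhomM : forall A B E (g : hom B E) (f : hom A B),
    fhom (cmp g f) = cmp (fhom g) (fhom f) }.

Arguments fhom {C D} f {A B} _ : rename.

Program Definition functor_comp (C D E : category)
    (G : functor D E) (F : functor C D) : functor C E :=
  {| fobj A := G (F A); fhom A B f := fhom G (fhom F f) |}.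
Next Obligation. by move=> C D E G F A /=; rewrite !fhom1. Qed.
Next Obligation. by move=> C D E G F A B A' g f /=; rewrite !fhomM. Qed.

Program Definition full_subcat (C : category) (P : C -> Prop) : category :=
  {| obj := {A : C | P A};
     hom A B := hom (sval A) (sval B);
     idm A := idm (sval A);
     cmp A B D g f := cmp g f |}.
Next Obligation. by move=> C P A B f /=; apply: cmp1m. Qed.
Next Obligation. by move=> C P A B f /=; apply: cmpm1. Qed.
Next Obligation. by move=> C P A B D E h g f /=; apply: cmpA. Qed.

Program Definition full_incl (C : category) (P : C -> Prop) :
    functor (full_subcat P) C :=
  {| fobj A := sval A; fhom A B f := f |}.
Next Obligation. by []. Qed.
Next Obligation. by []. Qed.

Definition left_adjoint (C D : category) (F : functor C D) (G : functor D C) :=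
  exists phi : forall (A : C) (B : D), hom (F A) B -> hom A (G B),
    [/\ forall A B, bijective (phi A B),
        forall (A A' : C) (B : D) (f : hom A' A) (h : hom (F A) B),
          phi A' B (cmp h (fhom F f)) = cmp (phi A B h) f
      & forall (A : C) (B B' : D) (g : hom B B') (h : hom (F A) B),
          phi A B' (cmp g h) = cmp (fhom G g) (phi A B h)].

(* A fixed universe of sets; monads, and the hom-sets of the small categories
   below, live in it. *)
Definition Sets := Type.

Record monad := Monad {
  mobj :> Sets -> Sets;
  mmap : forall X Y : Sets, (X -> Y) -> mobj X -> mobj Y;
  mret : forall X : Sets, X -> mobj X;
  mmul : forall X : Sets, mobj (mobj X) -> mobj X;
  mmap_id : forall (X : Sets) (u : mobj X), mmap id u = u;
  mmap_comp : forall (X Y Z : Sets) (g : Y -> Z) (f : X -> Y) (u : mobj X),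
    mmap (g \o f) u = mmap g (mmap f u);
  mret_nat : forall (X Y : Sets) (f : X -> Y) (x : X),
    mmap f (mret x) = mret (f x);
  mmul_nat : forall (X Y : Sets) (f : X -> Y) (u : mobj (mobj X)),
    mmap f (mmul u) = mmul (mmap (mmap f) u);
  mmul_ret : forall (X : Sets) (u : mobj X), mmul (mret u) = u;
  mmul_map_ret : forall (X : Sets) (u : mobj X), mmul (mmap (@mret X) u) = u;
  mmul_mul : forall (X : Sets) (u : mobj (mobj (mobj X))),
    mmul (mmul u) = mmul (mmap (@mmul X) u) }.

Arguments mmap m {X Y} f u.
Arguments mret m {X} x.
Arguments mmul m {X} u.

Record monad_map (T S : monad) := MonadMap {
  mmor :> forall X : Sets, T X -> S X;
  mmor_nat : forall (X Y : Sets) (f : X -> Y) (u : T X),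
    mmor (mmap T f u) = mmap S f (mmor u);
  mmor_ret : forall (X : Sets) (x : X), mmor (mret T x) = mret S x;
  mmor_mul : forall (X : Sets) (u : T (T X)),
    mmor (mmul T u) = mmul S (mmap S (@mmor X) (mmor u)) }.

Lemma monad_map_eq (T S : monad) (s t : monad_map T S) :
  (forall (X : Sets) (u : T X), s X u = t X u) -> s = t.
Proof.
case: s => s s1 s2 s3; case: t => t t1 t2 t3 /= st.
have {}st : s = t.
  by apply: functional_extensionality_dep => X; apply: funext => u; apply: st.
by case: _ / st in t1 t2 t3 *; congr MonadMap; apply: Prop_irrelevance.
Qed.

Program Definition monad_map_id (T : monad) : monad_map T T :=
  {| mmor X u := u |}.
Next Obligation. by []. Qed.
Next Obligation. by []. Qed.
Next Obligation. by move=> T X u /=; rewrite -[u in LHS]mmap_id. Qed.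

Program Definition monad_map_comp (T S R : monad) (t : monad_map S R)
    (s : monad_map T S) : monad_map T R :=
  {| mmor X u := t X (s X u) |}.
Next Obligation. by move=> T S R t s X Y f u /=; rewrite !mmor_nat. Qed.
Next Obligation. by move=> T S R t s X x /=; rewrite !mmor_ret. Qed.
Next Obligation.
by move=> T S R t s X u /=; rewrite !mmor_mul mmor_nat -mmap_comp.
Qed.

Program Definition Mnd : category :=
  {| obj := monad; hom := monad_map;
     idm := monad_map_id; cmp := monad_map_comp |}.
Next Obligation. by move=> T S s /=; apply: monad_map_eq. Qed.
Next Obligation. by move=> T S s /=; apply: monad_map_eq. Qed.
Next Obligation. by move=> T S R Q u t s /=; apply: monad_map_eq. Qed.

Definition pair_swap (X Y : Type) (p : X * Y) : Y * X := (p.2, p.1).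

Definition st (T : monad) (X Y : Sets) (p : T X * Y) : T (X * Y)%type :=
  mmap T (fun x => (x, p.2)) p.1.

Definition st' (T : monad) (X Y : Sets) : X * T Y -> T (X * Y)%type :=
  mmap T (@pair_swap Y X) \o @st T Y X \o @pair_swap X (T Y).

Definition dst (T : monad) (X Y : Sets) : T X * T Y -> T (X * Y)%type :=
  @mmul T (X * Y)%type \o mmap T (@st' T X Y) \o @st T X (T Y).

Definition commutative_monad (T : monad) : Prop :=
  forall X Y : Sets,
    @dst T X Y = @mmul T (X * Y)%type \o mmap T (@st T X Y) \o @st' T (T X) Y.

Definition CMnd : category := @full_subcat Mnd commutative_monad.
Definition CMnd_incl : functor CMnd Mnd := @full_incl Mnd commutative_monad.

Record ncat := NCat {
  nhom :> nat -> nat -> Sets;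
  nid : forall n, nhom n n;
  ncmp : forall n m k, nhom m k -> nhom n m -> nhom n k;
  ncmp1m : forall n m (f : nhom n m), ncmp (nid m) f = f;
  ncmpm1 : forall n m (f : nhom n m), ncmp f (nid n) = f;
  ncmpA : forall n m k l (h : nhom k l) (g : nhom m k) (f : nhom n m),
    ncmp h (ncmp g f) = ncmp (ncmp h g) f }.

Arguments nid {C} n : rename.
Declare Scope ncat_scope.
Delimit Scope ncat_scope with nc.
Notation "g ∘ f" := (ncmp g f)
  (at level 40, left associativity) : ncat_scope.
Local Open Scope ncat_scope.

(* Functors that are the identity on objects. *)
Record nfunctor (C D : ncat) := NFunctor {
  nmap :> forall n m, C n m -> D n m;
  nmap1 : forall n, nmap (nid n) = nid n;
  nmapM : forall n m k (g : C m k) (f : C n m),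
    nmap (g ∘ f) = nmap g ∘ nmap f }.

Arguments nmap {C D} F {n m} _ : rename.

Lemma nfunctor_eq (C D : ncat) (F G : nfunctor C D) :
  (forall n m (f : C n m), F n m f = G n m f) -> F = G.
Proof.
case: F => F F1 F2; case: G => G G1 G2 /= FG.
have {}FG : F = G.
  apply: functional_extensionality_dep => n.
  by apply: functional_extensionality_dep => m; apply: funext => f; apply: FG.
by case: _ / FG in G1 G2 *; congr NFunctor; apply: Prop_irrelevance.
Qed.

Program Definition nfunctor_id (C : ncat) : nfunctor C C :=
  {| nmap n m f := f |}.
Next Obligation. by []. Qed.
Next Obligation. by []. Qed.

Program Definition nfunctor_comp (C D E : ncat)
    (G : nfunctor D E) (F : nfunctor C D) : nfunctor C E :=
  {| nmap n m f := G n m (F n m f) |}.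
Next Obligation. by move=> C D E G F n /=; rewrite !nmap1. Qed.
Next Obligation. by move=> C D E G F n m k g f /=; rewrite !nmapM. Qed.

Program Definition aleph0 : ncat :=
  {| nhom n m := 'I_n -> 'I_m; nid n := id; ncmp n m k g f := g \o f |}.
Next Obligation. by []. Qed.
Next Obligation. by []. Qed.
Next Obligation. by []. Qed.

Definition ninitial (C : ncat) (z : nat) : Prop :=
  forall m, exists! f : C z m, True.

Definition ncoproduct (C : ncat) n m s (i1 : C n s) (i2 : C m s) : Prop :=
  forall k (f : C n k) (g : C m k), exists! h : C s k, h ∘ i1 = f /\ h ∘ i2 = g.

Record law := Law {
  law_cat :> ncat;
  inc : nfunctor aleph0 law_cat;
  law_initial : ninitial law_cat 0;
  law_coproduct : forall n m,
    ncoproduct (inc _ _ (@lshift n m)) (inc _ _ (@rshift n m)) }.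

Arguments inc l : clear implicits.

(* A functor strictly preserves finite coproducts when it maps the chosen
   coprojections to the chosen coprojections; it then commutes with the
   inclusions of aleph0, see [law_map_inc]. *)
Record law_map (L K : law) := LawMap {
  law_fun :> nfunctor L K;
  law_inl : forall n m,
    law_fun _ _ (inc L _ _ (@lshift n m)) = inc K _ _ (@lshift n m);
  law_inr : forall n m,
    law_fun _ _ (inc L _ _ (@rshift n m)) = inc K _ _ (@rshift n m) }.

Lemma law_map_eq (L K : law) (F G : law_map L K) :
  (forall n m (f : L n m), F n m f = G n m f) -> F = G.
Proof.
case: F => F F1 F2; case: G => G G1 G2 /= /nfunctor_eq FG.
by case: _ / FG in G1 G2 *; congr LawMap; apply: Prop_irrelevance.
Qed.

Program Definition law_map_id (L : law) : law_map L L :=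
  {| law_fun := nfunctor_id L |}.
Next Obligation. by []. Qed.
Next Obligation. by []. Qed.

Program Definition law_map_comp (L K M : law) (G : law_map K M)
    (F : law_map L K) : law_map L M :=
  {| law_fun := nfunctor_comp G F |}.
Next Obligation. by move=> L K M G F n m /=; rewrite !law_inl. Qed.
Next Obligation. by move=> L K M G F n m /=; rewrite !law_inr. Qed.

Program Definition Law_cat : category :=
  {| obj := law; hom := law_map; idm := law_map_id; cmp := law_map_comp |}.
Next Obligation. by move=> L K F /=; apply: law_map_eq. Qed.
Next Obligation. by move=> L K F /=; apply: law_map_eq. Qed.
Next Obligation. by move=> L K M N H G F /=; apply: law_map_eq. Qed.

Definition pt n (a : 'I_n) : 'I_1 -> 'I_n := fun=> a.

Section Cotupling.
Variable L : law.

Lemma nmap_pt n m (f : 'I_n -> 'I_m) a :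
  inc L _ _ f ∘ inc L _ _ (pt a) = inc L _ _ (pt (f a)).
Proof. by rewrite -nmapM. Qed.

Lemma ext_pt n k (f g : L n k) :
  (forall a, f ∘ inc L _ _ (pt a) = g ∘ inc L _ _ (pt a)) -> f = g.
Proof.
elim: n f g => [|n IHn] f g fg.
  by have [h [_ hu]] := law_initial L k; rewrite -(hu f) // -(hu g).
have [h [_ hu]] := @law_coproduct L 1 n k
  (f ∘ inc L _ _ (@lshift 1 n)) (f ∘ inc L _ _ (@rshift 1 n)).
rewrite -(hu f) // -(hu g) //; split.
  have -> : @lshift 1 n = pt (lshift n (@ord0 0)).
    by apply: funext => i; rewrite (ord1 i).
  by rewrite fg.
by apply: IHn => a; rewrite -!ncmpA nmap_pt fg.
Qed.

Lemma cotupling_subproof n k (h : 'I_n -> L 1 k) :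
  exists c : L n k, forall a, c ∘ inc L _ _ (pt a) = h a.
Proof.
elim: n h => [|n IHn] h.
  by have [c _] := law_initial L k; exists c => -[].
have [c cP] := IHn (h \o @rshift 1 n).
have [d [[d1 d2] _]] := @law_coproduct L 1 n k (h (lshift n (@ord0 0))) c.
exists d => a; have := erefl (split (a : 'I_(1 + n))).
case: {2}(split _) => b Eab.
  have -> : a = lshift n b by rewrite -(splitK (a : 'I_(1 + n))) Eab.
  rewrite (ord1 b) -d1; congr (d ∘ inc _ _ _ _).
  by apply: funext => i; rewrite (ord1 i).
have -> : a = rshift 1 b by rewrite -(splitK (a : 'I_(1 + n))) Eab.
by rewrite -[RHS](cP b) -d2 -ncmpA nmap_pt.
Qed.

(* The cotuple [h_0, ..., h_(n-1)] : n -> k, as n = 1 + ... + 1. *)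
Definition cotup n k (h : 'I_n -> L 1 k) : L n k :=
  sval (cid (cotupling_subproof h)).

Lemma cotupE n k (h : 'I_n -> L 1 k) a :
  cotup h ∘ inc L _ _ (pt a) = h a.
Proof. exact: (svalP (cid (cotupling_subproof h)) a). Qed.

Lemma cotup_comp n k m (f : L k m) (h : 'I_n -> L 1 k) :
  f ∘ cotup h = cotup (fun a => f ∘ h a).
Proof. by apply: ext_pt => a; rewrite -ncmpA !cotupE. Qed.

Lemma cotup_inc n i k (h : 'I_n -> L 1 k) (f : 'I_i -> 'I_n) :
  cotup h ∘ inc L _ _ f = cotup (h \o f).
Proof. by apply: ext_pt => a; rewrite -ncmpA nmap_pt !cotupE. Qed.

Lemma cotup_pt n : cotup (fun a : 'I_n => inc L _ _ (pt a)) = nid n.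
Proof. by apply: ext_pt => a; rewrite cotupE ncmp1m. Qed.

(* The coproduct of morphisms g_0 + ... + g_(n-1). *)
Definition lsum n (j : 'I_n -> nat) (g : forall a, L 1 (j a)) :
    L n (\sum_a j a) :=
  cotup (fun a => inc L _ _ (@tagnat.Rank n j a) ∘ g a).

End Cotupling.

(* The cotuple [v_0, ..., v_(n-1)] of functions; [tagnat.sig1 c] and
   [tagnat.sig2 c] are the block containing c and the position of c in it. *)
Definition fcopair (X : Type) n (j : 'I_n -> nat)
    (v : forall a, 'I_(j a) -> X) (c : 'I_(\sum_a j a)) : X :=
  v (tagnat.sig1 c) (tagnat.sig2 c).

Lemma fcopairE (X : Type) n (j : 'I_n -> nat) (v : forall a, 'I_(j a) -> X)
  a (b : 'I_(j a)) : fcopair v (tagnat.Rank a b) = v a b.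
Proof. by rewrite /fcopair /tagnat.sig1 /tagnat.sig2 tagnat.rankK. Qed.

Section LawMapFacts.
Variables (L K : law) (F : law_map L K).

Lemma law_map_pt n (a : 'I_n) :
  F _ _ (inc L _ _ (pt a)) = inc K _ _ (pt a).
Proof.
have [k nE] : exists k, n = (a + (1 + k))%N.
  by exists (n - a.+1)%N; rewrite addnA addn1 subnKC.
case: a nE => /= a lt_an nE; subst n.
have -> : pt (Ordinal lt_an) = @rshift a (1 + k) \o @lshift 1 k.
  apply: funext => i; apply: val_inj => /=.
  by rewrite (ord1 i) /= addn0.
by rewrite !(nmapM _ (_ : aleph0 _ _) (_ : aleph0 _ _)) nmapM law_inl law_inr.
Qed.

Lemma law_map_inc n m (f : 'I_n -> 'I_m) :
  F _ _ (inc L _ _ f) = inc K _ _ f.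
Proof.
apply: ext_pt => a; rewrite -law_map_pt -nmapM nmap_pt.
by rewrite law_map_pt -nmap_pt law_map_pt.
Qed.

Lemma law_map_cotup n k (h : 'I_n -> L 1 k) :
  F _ _ (cotup h) = cotup (fun a => F _ _ (h a)).
Proof.
by apply: ext_pt => a; rewrite -law_map_pt -nmapM !cotupE law_map_pt cotupE.
Qed.

End LawMapFacts.

Local Open Scope quotient_scope.

Section LawMonad.
Variable L : law.

Section Carrier.
Variable X : Sets.

(* The coproduct of the sets L(1,i) x X^i; [Kappa g v] is the element (g, v) of
   the summand i. *)
Record preT : Sets := Kappa { ar : nat; op : L 1 ar; arg : 'I_ar -> X }.

Inductive preT_step : preT -> preT -> Prop :=
  PreTStep i m (f : 'I_i -> 'I_m) (g : L 1 i) (v : 'I_m -> X) :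
    preT_step (Kappa (inc L _ _ f ∘ g) v) (Kappa g (v \o f)).

Definition preT_sim : preT -> preT -> Prop :=
  Relation_Operators.clos_refl_sym_trans preT preT_step.

Definition preT_simb : rel {classic preT} := fun p q => `[< preT_sim p q >].

Lemma preT_simb_equiv : equiv_class_of preT_simb.
Proof.
split=> [p | p q | q p r].
- by apply/asboolP; apply: Relation_Operators.rst_refl.
- by apply/asboolP/asboolP; apply: Relation_Operators.rst_sym.
- move=> /asboolP pq /asboolP qr; apply/asboolP.
  exact: Relation_Operators.rst_trans pq qr.
Qed.

Canonical preT_simb_rel := EquivRelPack preT_simb_equiv.

Definition Tobj : Sets := {eq_quot preT_simb_rel}.

Definition cls (p : preT) : Tobj := \pi_Tobj%qT (p : {classic preT}).
Definition rep (u : Tobj) : preT := repr u.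

Lemma repK u : cls (rep u) = u.
Proof. exact: reprK. Qed.

Lemma cls_eq p q : cls p = cls q <-> preT_sim p q.
Proof.
split=> [/eqquotP/asboolP // | pq].
by apply/eqquotP/asboolP.
Qed.

Lemma cls_step i m (f : 'I_i -> 'I_m) (g : L 1 i) (v : 'I_m -> X) :
  cls (Kappa (inc L _ _ f ∘ g) v) = cls (Kappa g (v \o f)).
Proof. by apply/cls_eq; apply: Relation_Operators.rst_step. Qed.

Lemma cls_lift (A : Type) (phi : preT -> A) :
  (forall p q, preT_step p q -> phi p = phi q) ->
  forall p, phi (rep (cls p)) = phi p.
Proof.
move=> phiP p; have sim_phi q r : preT_sim q r -> phi q = phi r.
  by elim=> {q r} [q r /phiP | q | q r _ -> | q r s _ -> _ ->].
by apply/sim_phi/cls_eq/repK.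
Qed.

End Carrier.

Arguments op {X} p.
Arguments arg {X} p _.

Lemma clsK (X : Sets) (u : Tobj X) : cls (Kappa (op (rep u)) (arg (rep u))) = u.
Proof. by rewrite -[RHS]repK; case: (rep u). Qed.

(* [Tmap] and [Tmul] below are computed on chosen representatives; [TmapE] and
   [TmulE] show that the formulas hold for all representatives. *)
Definition Tmap (X Y : Sets) (h : X -> Y) (u : Tobj X) : Tobj Y :=
  cls (Kappa (op (rep u)) (h \o arg (rep u))).

Definition Tret (X : Sets) (x : X) : Tobj X :=
  cls (Kappa (nid 1) (fun=> x)).

Definition Tmul (X : Sets) (u : Tobj (Tobj X)) : Tobj X :=
  let p := rep u in
  cls (Kappa (lsum (fun a => op (rep (arg p a))) ∘ op p)
             (fcopair (fun a => arg (rep (arg p a))))).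

Lemma TmapE (X Y : Sets) (h : X -> Y) i (g : L 1 i) (v : 'I_i -> X) :
  Tmap h (cls (Kappa g v)) = cls (Kappa g (h \o v)).
Proof.
pose phi (p : preT X) := cls (Kappa (op p) (h \o arg p)).
by apply: (@cls_lift _ _ phi) => _ _ [] *; rewrite /phi /= cls_step.
Qed.

(* [p] is the restriction of [(g, w)] along some function. *)
Definition restricts (X : Sets) N (w : 'I_N -> X) (g : L 1 N) (p : preT X) : Prop :=
  exists2 r : 'I_(ar p) -> 'I_N, w \o r = arg p & inc L _ _ r ∘ op p = g.

Lemma lsum_restricts (X : Sets) N (w : 'I_N -> X) i (h : 'I_i -> L 1 N) (g : L 1 i)
    (d : 'I_i -> preT X) :
  (forall a, restricts w (h a) (d a)) ->
  cls (Kappa (lsum (fun a => op (d a)) ∘ g) (fcopair (fun a => arg (d a)))) =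
  cls (Kappa (cotup h ∘ g) w).
Proof.
move=> dP; pose r a := s2val (cid2 (dP a)).
have r1 a : w \o r a = arg (d a) by rewrite /r; case: cid2.
have r2 a : inc L _ _ (r a) ∘ op (d a) = h a by rewrite /r; case: cid2.
have -> : (fcopair (fun a => arg (d a))) = w \o fcopair r.
  by apply: funext => c; rewrite /fcopair /= -r1.
rewrite -cls_step ncmpA cotup_comp; congr (cls (Kappa (cotup _ ∘ _) _)).
apply: funext => a; rewrite -r2 ncmpA -nmapM; congr (inc _ _ _ _ ∘ _).
by apply: funext => b; rewrite /= fcopairE.
Qed.

Lemma restricts_sim (X : Sets) i (g : L 1 i) (d d' : 'I_i -> preT X) :
  (forall a, cls (d a) = cls (d' a)) ->
  cls (Kappa (lsum (fun a => op (d a)) ∘ g) (fcopair (fun a => arg (d a)))) =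
  cls (Kappa (lsum (fun a => op (d' a)) ∘ g) (fcopair (fun a => arg (d' a)))).
Proof.
pose Phi (d : 'I_i -> preT X) :=
  cls (Kappa (lsum (fun a => op (d a)) ∘ g) (fcopair (fun a => arg (d a)))).
rewrite -/(Phi d) -/(Phi d').
pose upd (e : 'I_i -> preT X) a p b := if b == a then p else e b.
have Phi_step e a p q : preT_step p q -> Phi (upd e a p) = Phi (upd e a q).
  move=> pq; pose N := \sum_b ar (upd e a p b).
  pose w : 'I_N -> X := fcopair (fun b => arg (upd e a p b)).
  pose h b : L 1 N := inc L _ _ (tagnat.Rank b) ∘ op (upd e a p b).
  have hp b : restricts w (h b) (upd e a p b).
    exists (tagnat.Rank b) => //.
    by apply: funext => c; rewrite /w /= fcopairE.
  have hq b : restricts w (h b) (upd e a q b).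
    move: (hp b); rewrite /upd; case: eqP => // _.
    case: pq => k m f g' v [r /= rw rh]; exists (r \o f); rewrite /= -?rw //.
    by rewrite -rh ncmpA -nmapM.
  by rewrite /Phi (lsum_restricts _ hp) (lsum_restricts _ hq).
have Phi_sim e a p q : preT_sim p q -> Phi (upd e a p) = Phi (upd e a q).
  by elim=> {p q} [p q /Phi_step | p | p q _ -> | p q r _ -> _ ->].
move=> dd'; pose mix k (b : 'I_i) := if (b < k)%N then d' b else d b.
suff mixP k : (k <= i)%N -> Phi (mix k) = Phi d.
  rewrite -(mixP i) //; congr Phi; apply: funext => b.
  by rewrite /mix ltn_ord.
elim: k => [|k IHk] ki; first by congr Phi.
rewrite -IHk; last exact: ltnW.
pose a := Ordinal ki.
have mixS : mix k.+1 = upd (mix k) a (d' a).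
  apply: funext => b; rewrite /mix /upd ltnS leq_eqVlt -val_eqE /=.
  by case: eqP => //= ba; congr d'; apply: val_inj.
have mixk : upd (mix k) a (d a) = mix k.
  apply: funext => b; rewrite /upd.
  by case: eqP => [-> | _] //; rewrite /mix /= ltnn.
rewrite mixS -[in RHS]mixk; apply: Phi_sim.
by apply/cls_eq; rewrite dd'.
Qed.

Lemma TmulE (X : Sets) i (g : L 1 i) (v : 'I_i -> Tobj X)
    (j : 'I_i -> nat) (h : forall a, L 1 (j a)) (w : forall a, 'I_(j a) -> X) :
  (forall a, v a = cls (Kappa (h a) (w a))) ->
  Tmul (cls (Kappa g v)) = cls (Kappa (lsum h ∘ g) (fcopair w)).
Proof.
move=> vE; pose d a := Kappa (h a) (w a).
pose phi (p : preT (Tobj X)) :=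
  cls (Kappa (lsum (fun a => op (rep (arg p a))) ∘ op p)
             (fcopair (fun a => arg (rep (arg p a))))).
transitivity (phi (Kappa g v)); last first.
  by apply: (@restricts_sim _ _ _ _ d) => a; rewrite repK /= vE.
apply: (@cls_lift _ _ phi) => _ _ [k m f g' u]; rewrite /phi /=.
rewrite [RHS](@lsum_restricts _ _ (fcopair (fun a => arg (rep (u a)))) _
  (fun b => inc L _ _ (tagnat.Rank (f b)) ∘ op (rep (u (f b)))))//.
  by rewrite ncmpA /lsum cotup_inc.
move=> b; exists (tagnat.Rank (f b)) => //.
by apply: funext => c; rewrite /= fcopairE.
Qed.

Lemma TmulE_restricts (X : Sets) N (w : 'I_N -> X) i (h : 'I_i -> L 1 N)
    (g : L 1 i) (v : 'I_i -> Tobj X) :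
  (forall a, exists2 p, v a = cls p & restricts w (h a) p) ->
  Tmul (cls (Kappa g v)) = cls (Kappa (cotup h ∘ g) w).
Proof.
move=> vP; pose d a := s2val (cid2 (vP a)).
rewrite (@TmulE _ _ _ _ _ (fun a => op (d a)) (fun a => arg (d a))).
  by apply: lsum_restricts => a; rewrite /d; case: cid2.
by move=> a; rewrite /d; case: cid2 => -[].
Qed.

Lemma restricts_id (X : Sets) (p : preT X) : restricts (arg p) (op p) p.
Proof. by exists id; rewrite // nmap1 ncmp1m. Qed.

Program Definition T_law : monad :=
  {| mobj := Tobj; mmap := Tmap; mret := Tret; mmul := Tmul |}.
Next Obligation. by move=> X u; rewrite -(repK u); case: rep => *; apply: TmapE. Qed.
Next Obligation.
by move=> X Y Z g f u; rewrite -(repK u); case: rep => *; rewrite !TmapE.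
Qed.
Next Obligation. by move=> X Y f x; apply: TmapE. Qed.
Next Obligation.
move=> X Y f u; rewrite -(repK u); case: (rep u) => i g v.
rewrite TmapE (@TmulE _ _ _ _ _ _ _ (fun a => esym (clsK (v a)))).
pose w a := f \o arg (rep (v a)).
rewrite TmapE (@TmulE _ _ _ _ _ (fun a => op (rep (v a))) w) //.
Qed.
Next Obligation.
move=> X u; rewrite -[RHS](repK u).
rewrite (@TmulE_restricts _ _ (arg (rep u)) _ (fun=> op (rep u))).
  have -> : (fun _ : 'I_1 => op (rep u)) =
            (fun a => op (rep u) ∘ inc L _ _ (pt a)).
    apply: funext => a; rewrite (_ : pt a = id) ?nmap1 ?ncmpm1 //.
    by apply: funext => b; rewrite /pt !ord1.
  by rewrite -cotup_comp cotup_pt !ncmpm1 clsK repK.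
by move=> a; exists (rep u); rewrite ?repK //; apply: restricts_id.
Qed.
Next Obligation.
move=> X u; rewrite -(repK u); case: (rep u) => i g v; rewrite TmapE.
rewrite (@TmulE_restricts _ _ v _ (fun a => inc L _ _ (pt a))).
  by rewrite cotup_pt ncmp1m.
move=> a; exists (Kappa (nid 1) (fun=> v a)) => //.
by exists (pt a); rewrite //= ncmpm1.
Qed.
Next Obligation.
move=> X u; rewrite -(repK u); case: (rep u) => i g v; rewrite TmapE.
pose J a := ar (rep (v a)); pose h a := op (rep (v a)).
pose w : forall a, 'I_(J a) -> _ := fun a => arg (rep (v a)).
rewrite (@TmulE _ _ g v J h w); last by move=> a; rewrite clsK.
pose W c := rep (fcopair w c).
have WE c : fcopair w c = cls (Kappa (op (W c)) (arg (W c))).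
  by rewrite clsK.
rewrite (TmulE _ WE) ncmpA cotup_comp.
symmetry; apply: TmulE_restricts => a.
pose H c := inc L _ _ (@tagnat.Rank _ (fun c => ar (W c)) c) ∘ op (W c).
pose p := Kappa (cotup (fun b => H (tagnat.Rank a b)) ∘ h a)
  (fcopair (fun c => arg (W c))).
exists p.
  rewrite /= -[v a]clsK /p.
  apply: TmulE_restricts => b; exists (W (tagnat.Rank a b)).
    by rewrite repK fcopairE.
  exists (tagnat.Rank (tagnat.Rank a b)) => //.
  by apply: funext => c; rewrite /= fcopairE.
rewrite ncmpA /lsum cotup_inc; exact: (restricts_id p).
Qed.

End LawMonad.

Arguments op {L X} p.
Arguments arg {L X} p _.

Section LawMonadMap.
Variables (L K : law) (F : law_map L K).

Definition Tmor (X : Sets) (u : T_law L X) : T_law K X :=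
  cls (Kappa (F _ _ (op (rep u))) (arg (rep u))).

Lemma TmorE (X : Sets) i (g : L 1 i) (v : 'I_i -> X) :
  Tmor (cls (Kappa g v)) = cls (Kappa (F _ _ g) v).
Proof.
pose phi (p : preT L X) := cls (Kappa (F _ _ (op p)) (arg p)).
apply: (@cls_lift _ _ _ phi) => _ _ [] *.
by rewrite /phi /= nmapM law_map_inc cls_step.
Qed.

Program Definition T_law_map : monad_map (T_law L) (T_law K) :=
  {| mmor := Tmor |}.
Next Obligation.
by move=> X Y f u; rewrite -(repK u); case: (rep u) => *; rewrite /= !(TmorE, TmapE).
Qed.
Next Obligation. by move=> X x; rewrite /= /Tret TmorE nmap1. Qed.
Next Obligation.
move=> X u; rewrite -(repK u); case: (rep u) => i g v /=.
pose h a := op (rep (v a)); pose w a := arg (rep (v a)).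
have vE a : v a = cls (Kappa (h a) (w a)).
  by rewrite clsK.
rewrite (TmulE _ vE) !TmorE TmapE.
rewrite (@TmulE _ _ _ _ _ _ (fun a => F _ _ (h a)) w) => [|a /=]; last first.
  by rewrite -TmorE clsK.
rewrite nmapM /lsum law_map_cotup.
by congr (cls (Kappa (cotup _ ∘ _) _)); apply: funext => a; rewrite nmapM law_map_inc.
Qed.

End LawMonadMap.

Program Definition T_functor : functor Law_cat Mnd :=
  {| fobj := T_law : Law_cat -> Mnd; fhom := T_law_map |}.
Next Obligation.
move=> L; apply: monad_map_eq => X u; rewrite -(repK u); case: (rep u) => *.
exact: TmorE.
Qed.
Next Obligation.
move=> L K M G F; apply: monad_map_eq => X u; rewrite -(repK u).
by case: (rep u) => *; rewrite /= !TmorE.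
Qed.

Definition niso (C : ncat) n m (f : C n m) : Prop :=
  exists2 g : C m n, g ∘ f = nid n & f ∘ g = nid m.

(* Symmetric monoidal structures whose tensor is multiplication on objects and
   whose unit is 1. *)
Record symmon (C : ncat) := SymMon {
  tens : forall n p m q, C n p -> C m q -> C (n * m) (p * q);
  assoc : forall n m p, C (n * m * p) (n * (m * p));
  lunit : forall n, C (1 * n) n;
  runit : forall n, C (n * 1) n;
  braid : forall n m, C (n * m) (m * n);
  tens1 : forall n m, tens (nid n) (nid m) = nid (n * m);
  tensM : forall n p r m q s
      (f' : C p r) (f : C n p) (g' : C q s) (g : C m q),
    tens (f' ∘ f) (g' ∘ g) = tens f' g' ∘ tens f g;
  assoc_iso : forall n m p, niso (assoc n m p);
  lunit_iso : forall n, niso (lunit n);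
  runit_iso : forall n, niso (runit n);
  assoc_nat : forall n n' m m' p p' (f : C n n') (g : C m m') (h : C p p'),
    assoc n' m' p' ∘ tens (tens f g) h = tens f (tens g h) ∘ assoc n m p;
  lunit_nat : forall n m (f : C n m),
    lunit m ∘ tens (nid 1) f = f ∘ lunit n;
  runit_nat : forall n m (f : C n m),
    runit m ∘ tens f (nid 1) = f ∘ runit n;
  braid_nat : forall n p m q (f : C n p) (g : C m q),
    braid p q ∘ tens f g = tens g f ∘ braid n m;
  braidK : forall n m, braid m n ∘ braid n m = nid (n * m);
  triangle : forall n m,
    tens (nid n) (lunit m) ∘ assoc n 1 m = tens (runit n) (nid m);
  pentagon : forall n m p q,
    assoc n m (p * q) ∘ assoc (n * m) p q =
    tens (nid n) (assoc m p q) ∘ assoc n (m * p) q ∘ tens (assoc n m p) (nid q);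
  hexagon : forall n m p,
    assoc m p n ∘ braid n (m * p) ∘ assoc n m p =
    tens (nid m) (braid n p) ∘ assoc m n p ∘ tens (braid n m) (nid p) }.

Arguments tens {C} s {n p m q} f g : rename.
Arguments assoc {C} s n m p : rename.
Arguments lunit {C} s n : rename.
Arguments runit {C} s n : rename.
Arguments braid {C} s n m : rename.

Record strict_symmon (C D : ncat) (M : symmon C) (N : symmon D)
    (F : nfunctor C D) : Prop := StrictSymMon {
  strict_tens : forall n p m q (f : C n p) (g : C m q),
    F _ _ (tens M f g) = tens N (F _ _ f) (F _ _ g);
  strict_assoc : forall n m p, F _ _ (assoc M n m p) = assoc N n m p;
  strict_lunit : forall n, F _ _ (lunit M n) = lunit N n;
  strict_runit : forall n, F _ _ (runit M n) = runit N n;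
  strict_braid : forall n m, F _ _ (braid M n m) = braid N n m }.

(* The symmetric monoidal structure of aleph0 is that of sets and cartesian
   products, transported along the bijection c |-> (a, b), c = a * m + b. *)

Lemma co_subproof1 n m (c : 'I_(n * m)) : (c %/ m < n)%N.
Proof.
case: m c => [|m] c; last by rewrite ltn_divLR.
by have := ltn_ord c; rewrite {2}muln0.
Qed.

Lemma co_subproof2 n m (c : 'I_(n * m)) : (c %% m < m)%N.
Proof.
case: m c => [|m] c; last by rewrite ltn_pmod.
by have := ltn_ord c; rewrite {2}muln0.
Qed.

Lemma coinv_subproof n m (p : 'I_n * 'I_m) : (p.1 * m + p.2 < n * m)%N.
Proof.
apply: (@leq_trans (p.1.+1 * m)); last by rewrite leq_mul2r ltn_ord orbT.
by rewrite mulSn addnC ltn_add2r.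
Qed.

Definition co n m (c : 'I_(n * m)) : 'I_n * 'I_m :=
  (Ordinal (co_subproof1 c), Ordinal (co_subproof2 c)).

Definition coinv n m (p : 'I_n * 'I_m) : 'I_(n * m) :=
  Ordinal (coinv_subproof p).

Lemma coK n m : cancel (@co n m) (@coinv n m).
Proof. by move=> c; apply: val_inj; rewrite /= -divn_eq. Qed.

Lemma coinvK n m : cancel (@coinv n m) (@co n m).
Proof.
move=> [a b]; have m_gt0 : (0 < m)%N by apply: leq_ltn_trans (ltn_ord b).
congr pair; apply: val_inj => /=.
  by rewrite divnMDl // divn_small ?addn0.
by rewrite modnMDl modn_small.
Qed.

Lemma coinv_ind n m (P : 'I_(n * m) -> Prop) :
  (forall a b, P (coinv (a, b))) -> forall c, P c.
Proof. by move=> PP c; rewrite -(coK c); case: (co c). Qed.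

Arguments co : simpl never.
Arguments coinv : simpl never.

Definition aleph0_tens n p m q (f : 'I_n -> 'I_p) (g : 'I_m -> 'I_q)
    (c : 'I_(n * m)) : 'I_(p * q) :=
  coinv (f (co c).1, g (co c).2).

Definition aleph0_assoc n m p (c : 'I_(n * m * p)) : 'I_(n * (m * p)) :=
  coinv ((co (co c).1).1, coinv ((co (co c).1).2, (co c).2)).

Definition aleph0_assoc_inv n m p (c : 'I_(n * (m * p))) : 'I_(n * m * p) :=
  coinv (coinv ((co c).1, (co (co c).2).1), (co (co c).2).2).

Definition aleph0_lunit n (c : 'I_(1 * n)) : 'I_n := (co c).2.

Definition aleph0_runit n (c : 'I_(n * 1)) : 'I_n := (co c).1.

Definition aleph0_braid n m (c : 'I_(n * m)) : 'I_(m * n) :=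
  coinv (pair_swap (co c)).

Lemma aleph0_tensE n p m q (f : 'I_n -> 'I_p) (g : 'I_m -> 'I_q) a b :
  aleph0_tens f g (coinv (a, b)) = coinv (f a, g b).
Proof. by rewrite /aleph0_tens coinvK. Qed.

Lemma aleph0_assocE n m p (a : 'I_n) (b : 'I_m) (c : 'I_p) :
  aleph0_assoc (coinv (coinv (a, b), c)) = coinv (a, coinv (b, c)).
Proof. by rewrite /aleph0_assoc !coinvK. Qed.

Lemma aleph0_assoc_invE n m p (a : 'I_n) (b : 'I_m) (c : 'I_p) :
  aleph0_assoc_inv (coinv (a, coinv (b, c))) = coinv (coinv (a, b), c).
Proof. by rewrite /aleph0_assoc_inv !coinvK. Qed.

Lemma aleph0_lunitE n i (a : 'I_n) : aleph0_lunit (coinv (i, a)) = a.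
Proof. by rewrite /aleph0_lunit coinvK. Qed.

Lemma aleph0_runitE n i (a : 'I_n) : aleph0_runit (coinv (a, i)) = a.
Proof. by rewrite /aleph0_runit coinvK. Qed.

Lemma aleph0_braidE n m (a : 'I_n) (b : 'I_m) :
  aleph0_braid (coinv (a, b)) = coinv (b, a).
Proof. by rewrite /aleph0_braid coinvK. Qed.

Definition aleph0E := (aleph0_tensE, aleph0_assocE, aleph0_assoc_invE,
  aleph0_lunitE, aleph0_runitE, aleph0_braidE).

Arguments aleph0_tens : simpl never.
Arguments aleph0_assoc : simpl never.
Arguments aleph0_assoc_inv : simpl never.
Arguments aleph0_lunit : simpl never.
Arguments aleph0_runit : simpl never.
Arguments aleph0_braid : simpl never.

Lemma aleph0_assocK n m p : cancel (@aleph0_assoc n m p) (@aleph0_assoc_inv n m p).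
Proof.
by elim/coinv_ind=> + c; elim/coinv_ind=> a b; rewrite /= !aleph0E.
Qed.

Lemma aleph0_assoc_invK n m p :
  cancel (@aleph0_assoc_inv n m p) (@aleph0_assoc n m p).
Proof.
by elim/coinv_ind=> a; elim/coinv_ind=> b c; rewrite /= !aleph0E.
Qed.

Lemma aleph0_lunitK n : cancel (@aleph0_lunit n) (fun a => coinv (ord0, a)).
Proof. by elim/coinv_ind=> i a; rewrite (ord1 i); rewrite /= !aleph0E. Qed.

Lemma aleph0_runitK n : cancel (@aleph0_runit n) (fun a => coinv (a, ord0)).
Proof. by elim/coinv_ind=> a i; rewrite (ord1 i); rewrite /= !aleph0E. Qed.

Program Definition aleph0_symmon : symmon aleph0 :=
  {| tens := aleph0_tens; assoc := aleph0_assoc; lunit := aleph0_lunit;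
     runit := aleph0_runit; braid := aleph0_braid |}.
Next Obligation.
by move=> n m; apply: funext; elim/coinv_ind=> a b; rewrite /= !aleph0E.
Qed.
Next Obligation.
by move=> *; apply: funext; elim/coinv_ind=> a b; rewrite /= !aleph0E.
Qed.
Next Obligation.
move=> n m p; exists (@aleph0_assoc_inv n m p).
  by apply: funext => c; apply: aleph0_assocK.
by apply: funext => c; apply: aleph0_assoc_invK.
Qed.
Next Obligation.
move=> n; exists (fun a => coinv (ord0, a)).
  by apply: funext => c; apply: aleph0_lunitK.
by apply: funext => a; rewrite /= aleph0E.
Qed.
Next Obligation.
move=> n; exists (fun a => coinv (a, ord0)).
  by apply: funext => c; apply: aleph0_runitK.
by apply: funext => a; rewrite /= aleph0E.
Qed.
Next Obligation.
by move=> *; apply: funext; elim/coinv_ind=> + c; elim/coinv_ind=> a b; rewrite /= !aleph0E.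
Qed.
Next Obligation. by move=> *; apply: funext; elim/coinv_ind=> a b; rewrite /= !aleph0E. Qed.
Next Obligation. by move=> *; apply: funext; elim/coinv_ind=> a b; rewrite /= !aleph0E. Qed.
Next Obligation. by move=> *; apply: funext; elim/coinv_ind=> a b; rewrite /= !aleph0E. Qed.
Next Obligation. by move=> *; apply: funext; elim/coinv_ind=> a b; rewrite /= !aleph0E. Qed.
Next Obligation.
by move=> *; apply: funext; elim/coinv_ind=> + c; elim/coinv_ind=> a b; rewrite /= !aleph0E.
Qed.
Next Obligation.
move=> *; apply: funext; elim/coinv_ind=> + d; elim/coinv_ind=> + c.
by elim/coinv_ind=> a b; rewrite /= !aleph0E.
Qed.
Next Obligation.
by move=> *; apply: funext; elim/coinv_ind=> + c; elim/coinv_ind=> a b; rewrite /= !aleph0E.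
Qed.

Record smlaw := SMLaw {
  sml_law :> law;
  sml_symmon : symmon sml_law;
  sml_strict : strict_symmon aleph0_symmon sml_symmon (inc sml_law) }.

Record smlaw_map (L K : smlaw) := SMLawMap {
  sml_map :> law_map L K;
  sml_map_strict : strict_symmon (sml_symmon L) (sml_symmon K) sml_map }.

Lemma smlaw_map_eq (L K : smlaw) (F G : smlaw_map L K) :
  (forall n m (f : L n m), F n m f = G n m f) -> F = G.
Proof.
case: F => F F1; case: G => G G1 /= /law_map_eq FG.
by case: _ / FG in G1 *; congr SMLawMap; apply: Prop_irrelevance.
Qed.

Program Definition smlaw_map_id (L : smlaw) : smlaw_map L L :=
  {| sml_map := law_map_id L |}.
Next Obligation. by []. Qed.

Program Definition smlaw_map_comp (L K M : smlaw) (G : smlaw_map K M)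
    (F : smlaw_map L K) : smlaw_map L M :=
  {| sml_map := law_map_comp G F |}.
Next Obligation.
move=> L K M G F; have [F1 F2 F3 F4 F5] := sml_map_strict F.
have [G1 G2 G3 G4 G5] := sml_map_strict G.
by split=> * /=; rewrite ?F1 ?G1 ?F2 ?G2 ?F3 ?G3 ?F4 ?G4 ?F5 ?G5.
Qed.

Program Definition SMLaw_cat : category :=
  {| obj := smlaw; hom := smlaw_map;
     idm := smlaw_map_id; cmp := smlaw_map_comp |}.
Next Obligation. by move=> L K F; apply: smlaw_map_eq. Qed.
Next Obligation. by move=> L K F; apply: smlaw_map_eq. Qed.
Next Obligation. by move=> L K M N H G F; apply: smlaw_map_eq. Qed.

Program Definition SMLaw_forget : functor SMLaw_cat Law_cat :=
  {| fobj := sml_law : SMLaw_cat -> Law_cat; fhom := sml_map |}.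
Next Obligation. by []. Qed.
Next Obligation. by []. Qed.

Section Kleisli.
Variable T : monad.

Program Definition Kl : ncat :=
  {| nhom n m := 'I_n -> T 'I_m;
     nid n := mret T;
     ncmp n m k g f := fun a => mmul T (mmap T g (f a)) |}.
Next Obligation. by move=> n m f; apply: funext => a; apply: mmul_map_ret. Qed.
Next Obligation.
by move=> n m f; apply: funext => a; rewrite mret_nat mmul_ret.
Qed.
Next Obligation.
move=> n m k l h g f; apply: funext => a.
by rewrite mmul_nat mmul_mul -!mmap_comp.
Qed.

Program Definition Kl_inc : nfunctor aleph0 Kl :=
  {| nmap n m f := fun a => mret T (f a) |}.
Next Obligation. by []. Qed.
Next Obligation.
by move=> n m k g f; apply: funext => a /=; rewrite mret_nat mmul_ret.
Qed.

Program Definition Kl_law : law := {| law_cat := Kl; inc := Kl_inc |}.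
Next Obligation.
move=> m; have f : Kl 0 m by case.
by exists f; split=> // g _; apply: funext => -[].
Qed.
Next Obligation.
move=> n m k f g.
exists (fun c => match split c with inl a => f a | inr b => g b end); split.
  split; apply: funext => a /=; rewrite mret_nat mmul_ret.
    by rewrite -[lshift _ _]/(unsplit (inl a)) unsplitK.
  by rewrite -[rshift _ _]/(unsplit (inr a)) unsplitK.
move=> h [/= hf hg]; apply: funext => c; rewrite -{2}(splitK c).
case: (split c) => a /=.
  by rewrite -hf mret_nat mmul_ret.
by rewrite -hg mret_nat mmul_ret.
Qed.

Definition bind (X Y : Sets) (u : T X) (k : X -> T Y) : T Y := mmul T (mmap T k u).

Lemma bind_ret (X Y : Sets) (x : X) (k : X -> T Y) : bind (mret T x) k = k x.
Proof. by rewrite /bind mret_nat mmul_ret. Qed.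

Lemma bind_retr (X : Sets) (u : T X) : bind u (mret T) = u.
Proof. exact: mmul_map_ret. Qed.

Lemma bind_bind (X Y Z : Sets) (u : T X) (k : X -> T Y) (l : Y -> T Z) :
  bind (bind u k) l = bind u (fun x => bind (k x) l).
Proof. by rewrite /bind mmul_nat mmul_mul -!mmap_comp. Qed.

Lemma map_bind (X Y : Sets) (f : X -> Y) (u : T X) :
  mmap T f u = bind u (fun x => mret T (f x)).
Proof. by rewrite /bind (mmap_comp (mret T) f) mmul_map_ret. Qed.

Lemma eq_bind (X Y : Sets) (u : T X) (k l : X -> T Y) :
  k =1 l -> bind u k = bind u l.
Proof. by move=> /funext ->. Qed.

Lemma dst_bind (X Y : Sets) (u : T X) (v : T Y) :
  dst (u, v) = bind u (fun x => bind v (fun y => mret T (x, y))).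
Proof.
rewrite /dst /st' /st /= -/(bind _ _) map_bind bind_bind.
apply: eq_bind => x; rewrite bind_ret /= !map_bind bind_bind.
by apply: eq_bind => y; rewrite bind_ret.
Qed.

(* The tensor product of morphisms, for commutative T. *)
Definition Kl_tens n p m q (f : Kl n p) (g : Kl m q) : Kl (n * m) (p * q) :=
  fun c => mmap T (@coinv p q) (dst (f (co c).1, g (co c).2)).

Lemma Kl_tens_bind n p m q (f : Kl n p) (g : Kl m q) c :
  Kl_tens f g c = bind (f (co c).1) (fun x =>
    bind (g (co c).2) (fun y => mret T (coinv (x, y)))).
Proof.
rewrite /Kl_tens dst_bind map_bind bind_bind; apply: eq_bind => x.
by rewrite bind_bind; apply: eq_bind => y; rewrite bind_ret.
Qed.

Lemma Kl_tensE n p m q (f : Kl n p) (g : Kl m q) a b :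
  Kl_tens f g (coinv (a, b)) =
  bind (f a) (fun x => bind (g b) (fun y => mret T (coinv (x, y)))).
Proof. by rewrite Kl_tens_bind coinvK. Qed.

Lemma Kl_tens_inc n p m q (f : aleph0 n p) (g : aleph0 m q) :
  Kl_inc _ _ (tens aleph0_symmon f g) = Kl_tens (Kl_inc _ _ f) (Kl_inc _ _ g).
Proof. by apply: funext => c; rewrite Kl_tens_bind /= !bind_ret. Qed.

Lemma Kl_tens1 n m : Kl_tens (nid n) (nid m) = nid (n * m).
Proof.
by rewrite -!(nmap1 Kl_inc) -Kl_tens_inc tens1.
Qed.

Lemma Kl_iso n m (f : aleph0 n m) : niso f -> niso (Kl_inc _ _ f).
Proof.
by case=> g gf fg; exists (Kl_inc _ _ g); rewrite -nmapM ?gf ?fg nmap1.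
Qed.

Lemma KlM n m k (g : Kl m k) (f : Kl n m) : g ∘ f = fun a => bind (f a) g.
Proof. by []. Qed.

Hypothesis Tcomm : commutative_monad T.

Lemma bindC (X Y Z : Sets) (u : T X) (v : T Y) (k : X -> Y -> T Z) :
  bind u (fun x => bind v (fun y => k x y)) =
  bind v (fun y => bind u (fun x => k x y)).
Proof.
transitivity (bind (dst (u, v)) (fun p => k p.1 p.2)).
  rewrite dst_bind bind_bind; apply: eq_bind => x.
  by rewrite bind_bind; apply: eq_bind => y; rewrite bind_ret.
rewrite Tcomm /st' /st /= -/(bind _ _) !map_bind !bind_bind.
apply: eq_bind => y; rewrite !bind_ret /= map_bind bind_bind.
by apply: eq_bind => x; rewrite bind_ret.
Qed.

Program Definition Kl_symmon : symmon Kl :=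
  {| tens := Kl_tens;
     assoc n m p := Kl_inc _ _ (assoc aleph0_symmon n m p);
     lunit n := Kl_inc _ _ (lunit aleph0_symmon n);
     runit n := Kl_inc _ _ (runit aleph0_symmon n);
     braid n m := Kl_inc _ _ (braid aleph0_symmon n m) |}.
Next Obligation. exact: Kl_tens1. Qed.
Next Obligation.
move=> n p r m q s f' f g' g; apply: funext => c.
rewrite !KlM !Kl_tens_bind !bind_bind; apply: eq_bind => x.
rewrite bind_bind.
under eq_bind do rewrite bind_bind.
rewrite bindC; apply: eq_bind => y.
rewrite bind_ret Kl_tens_bind coinvK /=; apply: eq_bind => z.
by [].
Qed.
Next Obligation. by move=> n m p; apply/Kl_iso/assoc_iso. Qed.
Next Obligation. by move=> n; apply/Kl_iso/lunit_iso. Qed.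
Next Obligation. by move=> n; apply/Kl_iso/runit_iso. Qed.
Next Obligation.
move=> n n' m m' p p' f g h; apply: funext.
elim/coinv_ind=> + c; elim/coinv_ind=> a b.
rewrite !KlM bind_ret /= aleph0_assocE !Kl_tensE !bind_bind.
apply: eq_bind => x; rewrite !bind_bind.
apply: eq_bind => y; rewrite bind_ret !bind_bind.
by apply: eq_bind => z; rewrite !bind_ret /= aleph0_assocE.
Qed.
Next Obligation.
move=> n m f; apply: funext; elim/coinv_ind=> i a.
rewrite !KlM bind_ret /= aleph0_lunitE Kl_tensE bind_bind bind_ret bind_bind.
rewrite -[RHS]bind_retr; apply: eq_bind => x.
by rewrite bind_ret /= aleph0_lunitE.
Qed.
Next Obligation.
move=> n m f; apply: funext; elim/coinv_ind=> a i.
rewrite !KlM bind_ret /= aleph0_runitE Kl_tensE bind_bind.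
rewrite -[RHS]bind_retr; apply: eq_bind => x.
by rewrite !bind_ret /= aleph0_runitE.
Qed.
Next Obligation.
move=> n p m q f g; apply: funext; elim/coinv_ind=> a b.
rewrite !KlM bind_ret /= aleph0_braidE !Kl_tensE bind_bind.
rewrite bindC; apply: eq_bind => x; rewrite bind_bind; apply: eq_bind => y.
by rewrite bind_ret /= aleph0_braidE.
Qed.
Next Obligation. by move=> n m; rewrite -nmapM braidK nmap1. Qed.
Next Obligation.
by move=> n m; rewrite -!(nmap1 Kl_inc) -!Kl_tens_inc -nmapM triangle.
Qed.
Next Obligation.
by move=> n m p q; rewrite -!(nmap1 Kl_inc) -!Kl_tens_inc -!nmapM pentagon.
Qed.
Next Obligation.
by move=> n m p; rewrite -!(nmap1 Kl_inc) -!Kl_tens_inc -!nmapM hexagon.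
Qed.

Program Definition Kl_smlaw : smlaw :=
  {| sml_law := Kl_law; sml_symmon := Kl_symmon |}.
Next Obligation. by split=> // *; apply: Kl_tens_inc. Qed.

End Kleisli.

Section KleisliMap.
Variables (T S : monad) (s : monad_map T S).

Program Definition Kl_fun : nfunctor (Kl T) (Kl S) :=
  {| nmap n m f := fun a => s _ (f a) |}.
Next Obligation. by move=> n; apply: funext => a; apply: mmor_ret. Qed.
Next Obligation.
move=> n m k g f; apply: funext => a /=.
by rewrite mmor_mul mmor_nat -mmap_comp.
Qed.

Program Definition Kl_law_map : law_map (Kl_law T) (Kl_law S) :=
  {| law_fun := Kl_fun |}.
Next Obligation. by move=> n m; apply: funext => a; apply: mmor_ret. Qed.
Next Obligation. by move=> n m; apply: funext => a; apply: mmor_ret. Qed.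

Lemma mmor_dst (X Y : Sets) (p : T X * T Y) :
  s _ (dst p) = dst (s _ p.1, s _ p.2).
Proof.
rewrite /dst /st' /st /= mmor_mul !mmor_nat -!mmap_comp.
congr (mmul S (mmap S _ _)); apply: funext => x /=.
by rewrite !mmor_nat.
Qed.

Variables (Tcomm : commutative_monad T) (Scomm : commutative_monad S).

Program Definition Kl_smlaw_map :
    smlaw_map (Kl_smlaw Tcomm) (Kl_smlaw Scomm) :=
  {| sml_map := Kl_law_map |}.
Next Obligation.
split=> * /=; apply: funext => a /=; rewrite ?mmor_ret //.
by rewrite /Kl_tens mmor_nat mmor_dst.
Qed.

End KleisliMap.

Program Definition Kl_functor : functor CMnd SMLaw_cat :=
  {| fobj := (fun T => Kl_smlaw (svalP T)) : CMnd -> SMLaw_cat;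
     fhom T S s := Kl_smlaw_map s (svalP T) (svalP S) |}.
Next Obligation. by move=> T; apply: smlaw_map_eq. Qed.
Next Obligation. by move=> T S R t s; apply: smlaw_map_eq. Qed.

(* Main.v *)
(* Bifunctoriality and the unitors, which come from aleph0, force
   [g ⊗ h = (id ⊗ h) ∘ (g ⊗ id)], for [g : 1 -> i] and [h : 1 -> j], to be the
   cotuple over [a < i] of the maps [(b |-> (a, b)) ∘ h], precomposed with [g];
   symmetrically for [g ⊗ h = (g ⊗ id) ∘ (id ⊗ h)]. The two expressions are the two double
   strengths of T_L, so T_L is commutative. They also determine the tensor from
   the Lawvere theory, so every map in Law between symmetric monoidal theories is
   strict monoidal, and only Law and Mnd matter for the adjunction. There, a
   monad map s corresponds to the law map f |-> (a |-> s [f ∘ pt a, id]), with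
   inverse F |-> ([g, v] |-> T v (F g 0)). *)

From mathcomp Require Import all_boot all_order.
From mathcomp Require Import boolp.
Require Import Defs.

Set Implicit Arguments.
Unset Strict Implicit.
Unset Printing Implicit Defensive.
Local Obligation Tactic := idtac.
Local Open Scope ncat_scope.

Section Tensor.
Variable L : smlaw.
Local Notation M := (sml_symmon L).

Lemma tens_inc n p m q (f : 'I_n -> 'I_p) (g : 'I_m -> 'I_q) :
  tens M (inc L _ _ f) (inc L _ _ g) = inc L _ _ (aleph0_tens f g).
Proof. by rewrite -(strict_tens (sml_strict L)). Qed.

(** As [1 * 1] computes to [1], the point [coinv (a, b)] is the tensor of the points [a] and [b]. *)
Lemma tens_pt n p m q (f : L n p) (g : L m q) (a : 'I_n) (b : 'I_m) :
  tens M f g ∘ inc L _ _ (pt (coinv (a, b))) =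
  tens M (f ∘ inc L _ _ (pt a)) (g ∘ inc L _ _ (pt b)).
Proof. by rewrite tensM tens_inc. Qed.

(** Naturality of the right unitor, solved for the tensor: the unitor comes from [aleph0_runit],
    whose inverse is [b |-> coinv (b, ord0)]. *)
Lemma tens_nid1r n m (f : L n m) :
  tens M f (nid 1) =
  inc L _ _ (fun b => coinv (b, ord0)) ∘ f ∘ inc L _ _ (@aleph0_runit n).
Proof.
rewrite -ncmpA; have := runit_nat M f.
rewrite -!(strict_runit (sml_strict L)) /= => <-.
rewrite ncmpA -nmapM /=.
by rewrite (_ : _ \o _ = id) ?nmap1 ?ncmp1m //; apply/funext/aleph0_runitK.
Qed.

Lemma tens_nid1l n m (f : L n m) :
  tens M (nid 1) f =
  inc L _ _ (fun b => coinv (ord0, b)) ∘ f ∘ inc L _ _ (@aleph0_lunit n).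
Proof.
rewrite -ncmpA; have := lunit_nat M f.
rewrite -!(strict_lunit (sml_strict L)) /= => <-.
rewrite ncmpA -nmapM /=.
by rewrite (_ : _ \o _ = id) ?nmap1 ?ncmp1m //; apply/funext/aleph0_lunitK.
Qed.

(** Split as [(pt a ⊗ id) ∘ (id ⊗ f)]: the first factor comes from [aleph0], the second is given by
    the left unitor. *)
Lemma tens_ptl m q (f : L m q) n (a : 'I_n) :
  tens M (inc L _ _ (pt a)) f =
  inc L _ _ (fun b => coinv (a, b)) ∘ f ∘ inc L _ _ (@aleph0_lunit m).
Proof.
rewrite -[inc L _ _ (pt a)]ncmpm1 -[f in LHS]ncmp1m tensM tens_nid1l.
rewrite -(nmap1 (inc L)) tens_inc !ncmpA -nmapM.
congr (inc _ _ _ _ ∘ _ ∘ _).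
by apply: funext => b; rewrite /= aleph0_tensE.
Qed.

Lemma tens_ptr m q (f : L m q) n (b : 'I_n) :
  tens M f (inc L _ _ (pt b)) =
  inc L _ _ (fun a => coinv (a, b)) ∘ f ∘ inc L _ _ (@aleph0_runit m).
Proof.
rewrite -[inc L _ _ (pt b)]ncmpm1 -[f in LHS]ncmp1m tensM tens_nid1r.
rewrite -(nmap1 (inc L)) tens_inc !ncmpA -nmapM.
congr (inc _ _ _ _ ∘ _ ∘ _).
by apply: funext => a; rewrite /= aleph0_tensE.
Qed.

Lemma inc_ord1 (f : 'I_1 -> 'I_1) : inc L _ _ f = nid 1.
Proof.
rewrite -(nmap1 (inc L)); congr (inc L _ _ _).
by apply: funext => a; rewrite !ord1.
Qed.

(* The ascription relies on [1 * 1] being convertible to [1]. *)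
Lemma tens_cotupl i j (g : L 1 i) (h : L 1 j) :
  (tens M g h : L 1 (i * j)) =
  cotup (fun a => inc L _ _ (fun b => coinv (a, b)) ∘ h) ∘ g.
Proof.
rewrite -[g in LHS]ncmp1m -[h in LHS]ncmpm1 tensM tens_nid1r.
rewrite (inc_ord1 (@aleph0_runit 1)) ncmpm1 ncmpA; congr (_ ∘ _).
(* What remains is [id ⊗ h] at the point [coinv (a, ord0)], that is, [pt a ⊗ h] up to the only
   endomap of ['I_1]. *)
apply: ext_pt => a; rewrite cotupE -ncmpA nmap_pt tens_pt ncmp1m tens_ptl.
by rewrite (inc_ord1 (@aleph0_lunit 1)) !inc_ord1 !ncmpm1.
Qed.

Lemma tens_cotupr i j (g : L 1 i) (h : L 1 j) :
  (tens M g h : L 1 (i * j)) =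
  cotup (fun b => inc L _ _ (fun a => coinv (a, b)) ∘ g) ∘ h.
Proof.
rewrite -[h in LHS]ncmp1m -[g in LHS]ncmpm1 tensM tens_nid1l.
rewrite (inc_ord1 (@aleph0_lunit 1)) ncmpm1 ncmpA; congr (_ ∘ _).
apply: ext_pt => b; rewrite cotupE -ncmpA nmap_pt tens_pt ncmp1m tens_ptr.
by rewrite (inc_ord1 (@aleph0_runit 1)) !inc_ord1 !ncmpm1.
Qed.

End Tensor.

Section StrictLawMap.
Variables (L K : smlaw) (F : law_map L K).

Lemma law_map_strict : strict_symmon (sml_symmon L) (sml_symmon K) F.
Proof.
split=> [n p m q f g | * | * | * | *].
- apply: ext_pt; elim/coinv_ind => a b.
  (* At a point, both sides are tensors of morphisms out of [1], which [tens_cotupl] expresses by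
     cotuples, composition and [inc]. *)
  rewrite -{1}(law_map_pt F) -nmapM !tens_pt !tens_cotupl nmapM law_map_cotup.
  rewrite nmapM law_map_pt; congr (cotup _ ∘ _); apply: funext => c.
  by rewrite !nmapM law_map_inc law_map_pt.
- by rewrite -(strict_assoc (sml_strict L)) law_map_inc -(strict_assoc (sml_strict K)).
- by rewrite -(strict_lunit (sml_strict L)) law_map_inc -(strict_lunit (sml_strict K)).
- by rewrite -(strict_runit (sml_strict L)) law_map_inc -(strict_runit (sml_strict K)).
- by rewrite -(strict_braid (sml_strict L)) law_map_inc -(strict_braid (sml_strict K)).
Qed.

End StrictLawMap.

(** Presenting all values [k (v a)] over one common tuple [w] avoids the sum of arities in
    [Tmul]. *)
Lemma T_law_bindE (L : law) (X Y : Sets) i (g : L 1 i) (v : 'I_i -> X)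
    (k : X -> T_law L Y) N (h : 'I_i -> L 1 N) (w : 'I_N -> Y) :
  (forall a, exists2 p, k (v a) = cls p & restricts w (h a) p) ->
  bind (cls (Kappa g v) : T_law L X) k = cls (Kappa (cotup h ∘ g) w).
Proof. by move=> kP; rewrite /bind /= TmapE; apply: TmulE_restricts. Qed.

Lemma commutative_monad_bind (T : monad) :
  (forall (X Y : Sets) (u : T X) (v : T Y),
    bind u (fun x => bind v (fun y => mret T (x, y))) =
    bind v (fun y => bind u (fun x => mret T (x, y)))) ->
  commutative_monad T.
Proof.
move=> TC X Y; apply: funext => -[u v]; rewrite dst_bind TC.
rewrite /st' /st /= -/(bind _ _) !map_bind !bind_bind.
by apply: eq_bind => y; rewrite !bind_ret /= map_bind.
Qed.

Lemma T_law_commutative (L : smlaw) : commutative_monad (T_law L).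
Proof.
apply: commutative_monad_bind => X Y u v.
rewrite -(repK u) -(repK v); case: (rep u) (rep v) => [i g x] [j h y].
(* The [i * j] table of pairs serves both orders of binding: the inner bind yields row [a] in one
   order and column [b] in the other. *)
pose w c := (x (co c).1, y (co c).2).
transitivity (cls (Kappa (tens (sml_symmon L) g h) w : preT L _)).
  rewrite tens_cotupl; apply: T_law_bindE => a.
  exists (Kappa h (fun b => (x a, y b))).
    by rewrite -(map_bind (pair _)) /= TmapE.
  exists (fun b => coinv (a, b)) => //.
  by apply: funext => b; rewrite /w /comp coinvK.
rewrite tens_cotupr; symmetry; apply: T_law_bindE => b.
exists (Kappa g (fun a => (x a, y b))).
  by rewrite -(map_bind (pair^~ _)) /= TmapE.
exists (fun a => coinv (a, b)) => //.
by apply: funext => a; rewrite /w /comp coinvK.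
Qed.

(** Serves to show that [T_SM] restricts [T_functor] on the nose: the two composites have
    convertible actions and differ only in their proofs. *)
Lemma functor_eq (C D : category) (ob : C -> D)
  (h : forall A B, hom A B -> hom (ob A) (ob B)) p q p' q' :
  @Functor C D ob h p q = @Functor C D ob h p' q'.
Proof. by congr Functor; apply: Prop_irrelevance. Qed.

Program Definition T_SM : functor SMLaw_cat CMnd :=
  {| fobj := (fun L : smlaw => exist _ (T_law L) (T_law_commutative L))
       : SMLaw_cat -> CMnd;
     fhom L K F := T_law_map (sml_map F) |}.
Next Obligation. by move=> L; apply: (fhom1 T_functor). Qed.
Next Obligation.
move=> L K N G F.
exact: (fhomM T_functor (sml_map G : @hom Law_cat _ _)
  (sml_map F : @hom Law_cat _ _)).
Qed.

Section Transpose.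
Variables (L : law) (T : monad).

Section OfMonadMap.
Variable s : monad_map (T_law L) T.

Definition transpose_hom n m (f : L n m) : Kl T n m :=
  fun a => s _ (cls (Kappa (f ∘ inc L _ _ (pt a)) id)).

Lemma transpose_inc n m (f : 'I_n -> 'I_m) :
  transpose_hom (inc L _ _ f) = Kl_inc T _ _ f.
Proof.
apply: funext => a; rewrite /transpose_hom nmap_pt.
(* Moving the point into the arguments leaves [[nid 1, fun=> f a]], the unit of [T_law L] at
   [f a]. *)
by rewrite -[inc L _ _ _]ncmpm1 cls_step mmor_ret.
Qed.

Program Definition transpose_fun : nfunctor L (Kl T) :=
  {| nmap := transpose_hom |}.
Next Obligation. by move=> n; rewrite -(nmap1 (inc L)) transpose_inc. Qed.
Next Obligation.
move=> n m k g f; apply: funext => a; rewrite /transpose_hom /=.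
(* Pull [s] out of the Kleisli composite; what remains is a bind in [T_law L], where the cotuple of
   all [g ∘ pt b] is [g]. *)
rewrite (mmap_comp (s 'I_k) (fun b => cls (Kappa (g ∘ inc L _ _ (pt b)) id))).
rewrite -mmor_nat -mmor_mul; congr (s _).
rewrite -[RHS]/(bind _ _).
rewrite (@T_law_bindE _ _ _ _ _ _ _ _ (fun b => g ∘ inc L _ _ (pt b)) id).
  by rewrite -cotup_comp cotup_pt ncmpm1 ncmpA.
by move=> b; exists (Kappa (g ∘ inc L _ _ (pt b)) id); last exact: restricts_id.
Qed.

Program Definition transpose : law_map L (Kl_law T) :=
  {| law_fun := transpose_fun |}.
Next Obligation. by move=> n m; apply: transpose_inc. Qed.
Next Obligation. by move=> n m; apply: transpose_inc. Qed.

End OfMonadMap.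

Section OfLawMap.
Variable F : law_map L (Kl_law T).

Definition untranspose_mor (X : Sets) (u : T_law L X) : T X :=
  mmap T (arg (rep u)) (F _ _ (op (rep u)) ord0).

(** Independence of the representative: [F] preserves [inc], so [F (inc f ∘ g)] is [F g] mapped
    along [f]. *)
Lemma untransposeE (X : Sets) i (g : L 1 i) (v : 'I_i -> X) :
  untranspose_mor (cls (Kappa g v)) = mmap T v (F _ _ g ord0).
Proof.
pose phi (p : preT L X) := mmap T (arg p) (F _ _ (op p) ord0).
apply: (@cls_lift _ _ _ phi) => _ _ [k m f g' v'].
by rewrite /phi /= nmapM law_map_inc mmap_comp /= -/(bind _ _) -map_bind.
Qed.

Program Definition untranspose : monad_map (T_law L) T :=
  {| mmor := untranspose_mor |}.
Next Obligation.
move=> X Y f u; rewrite -(repK u); case: (rep u) => i g v.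
by rewrite /= TmapE !untransposeE mmap_comp.
Qed.
Next Obligation.
by move=> X x; rewrite /= untransposeE nmap1 /= mret_nat.
Qed.
Next Obligation.
move=> X u; rewrite -(repK u); case: (rep u) => i g v /=.
pose h a := op (rep (v a)); pose w a := arg (rep (v a)).
have vE a : v a = cls (Kappa (h a) (w a)) by rewrite clsK.
rewrite (TmulE _ vE) !untransposeE nmapM /= -mmap_comp mmul_nat -mmap_comp.
congr (mmul T (mmap T _ _)); apply: funext => a /=.
rewrite vE untransposeE.
(* Evaluating [F (lsum h)] at [a] is precomposing with the point [a], which leaves [h a] followed by
   the inclusion of block [a]; there [fcopair w] is [w a]. *)
transitivity (mmap T (fcopair w) (F _ _ (lsum h ∘ inc L _ _ (pt a)) ord0)).
  by rewrite nmapM law_map_pt /= mret_nat mmul_ret.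
rewrite cotupE nmapM law_map_inc /= -/(bind _ _) -map_bind -mmap_comp.
by congr (mmap T _ _); apply: funext => b; rewrite /= fcopairE.
Qed.

End OfLawMap.

(** A Yoneda argument: by naturality, [s] is determined by its values at the generic elements
    [[g, id]]. *)
Lemma transposeK : cancel transpose untranspose.
Proof.
move=> s; apply: monad_map_eq => X u; rewrite -(repK u); case: (rep u) => i g v.
rewrite /= untransposeE /= -mmor_nat /= TmapE.
by rewrite (_ : pt ord0 = id) ?nmap1 ?ncmpm1 //; apply: funext => a; rewrite !ord1.
Qed.

Lemma untransposeK : cancel untranspose transpose.
Proof.
move=> F; apply: law_map_eq => n m f; apply: funext => a.
rewrite /= /transpose_hom /= untransposeE mmap_id nmapM law_map_pt /=.
by rewrite mret_nat mmul_ret.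
Qed.

End Transpose.

Theorem lemma12 :
  exists T_SM : functor SMLaw_cat CMnd,
    functor_comp CMnd_incl T_SM = functor_comp T_functor SMLaw_forget /\
    left_adjoint T_SM Kl_functor.
Proof.
exists T_SM; split; first exact: functor_eq.
(* Strictness of the transpose is automatic, so [phi] inherits its inverse from [untranspose]. *)
pose phi (L : SMLaw_cat) (T : CMnd) (s : hom (T_SM L) T) : hom L (Kl_functor T) :=
  @SMLawMap L (Kl_smlaw (svalP T)) (transpose s) (law_map_strict _).
exists phi; split=> [L T | L K T F s | L T S t s].
- exists (fun F : smlaw_map L (Kl_smlaw (svalP T)) => @untranspose L (sval T) F).
    exact: transposeK.
  move=> F; apply: smlaw_map_eq => n m f.
  by rewrite /= -[in RHS](@untransposeK L (sval T) F).
- apply: smlaw_map_eq => n m f; apply: funext => a.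
  by rewrite /= /transpose_hom /= TmorE nmapM law_map_pt.
- by apply: smlaw_map_eq.
Qed.
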